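(* For any formulas $\alpha,\beta$ over a finite signature $\Sigma$, $\alpha$ strongly entails $\beta$ if and only if both of the following hold: (i) $[\![\alpha]\!]_c\subseteq[\![\beta]\!]_c$; (ii) $[\![\alpha]\!]_c\downarrow\cap[\![\beta]\!]\subseteq[\![\alpha]\!]$.
   Context: $\Sigma$ is a finite set of atoms. Formulas are given by $\alpha ::= \bot \mid p \mid \alpha_1\wedge\alpha_2 \mid \alpha_1\vee\alpha_2 \mid \alpha_1\rightarrow\alpha_2$ with $p\in\Sigma$. A partial interpretation is a map $v:\Sigma\to\{0,1,2\}$; $\mathcal I$ is the set of all of them and $\mathcal I_c$ the set of classical ones (no atom mapped to $1$). The $G_3$ valuation extends $v$ to formulas: $v(\bot)=0$, $v(\alpha\wedge\beta)=\min(v(\alpha),v(\beta))$, $v(\alpha\vee\beta)=\max(v(\alpha),v(\beta))$, $v(\alpha\to\beta)=2$ if $v(\alpha)\le v(\beta)$ and $=v(\beta)$ otherwise; $v$ is a model of $\alpha$ iff $v(\alpha)=2$. The order on $\mathcal I$: $u\le v$ iff for every atom $p$, $u(p)\le v(p)$ and ($u(p)=0$ implies $v(p)=0$). A classical interpretation $v\in\mathcal I_c$ is an equilibrium model of $\alpha$ iff it is a $\le$-minimal model of $\alpha$; $[\![\alpha]\!]_e$ denotes the set of equilibrium models of $\alpha$. For $S\subseteq\mathcal I$: $\overline S=\mathcal I\setminus S$; $S_c=S\cap\mathcal I_c$; $S\downarrow=\{u\in\mathcal I:\exists v\in S,\ v\ge u\}$ (so $S_c\downarrow=(S_c)\downarrow$).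 The denotation: $[\![\bot]\!]=\emptyset$; $[\![p]\!]=\{v\in\mathcal I: v(p)=2\}$; $[\![\alpha\wedge\beta]\!]=[\![\alpha]\!]\cap[\![\beta]\!]$; $[\![\alpha\vee\beta]\!]=[\![\alpha]\!]\cup[\![\beta]\!]$; $[\![\alpha\to\beta]\!]=\big(\overline{[\![\alpha]\!]}\cup[\![\beta]\!]\big)\cap\big(\overline{[\![\alpha]\!]}\cup[\![\beta]\!]\big)_c\downarrow$. We say $\alpha$ strongly entails $\beta$ iff for every formula $\gamma$ over $\Sigma$, $[\![\alpha\wedge\gamma]\!]_e\subseteq[\![\beta\wedge\gamma]\!]_e$. *)

(* Defs.v *)
From HB Require Import structures.
From mathcomp Require Import all_boot all_order.

Set Implicit Arguments.
Unset Strict Implicit.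
Unset Printing Implicit Defensive.

Inductive formula (Sigma : finType) : Type :=
| Bot
| Atom of Sigma
| And of formula Sigma & formula Sigma
| Or of formula Sigma & formula Sigma
| Imp of formula Sigma & formula Sigma.

Arguments Bot {Sigma}.

Definition interp (Sigma : finType) : finType := {ffun Sigma -> 'I_3}.

Section Semantics.

Variable Sigma : finType.
Implicit Types (u v : interp Sigma) (a b : formula Sigma).
Implicit Types S : {set interp Sigma}.

(* The truth values 0, 1, 2 are the elements of 'I_3; ord_max is the value 2. *)
Fixpoint val3 v a : 'I_3 :=
  match a with
  | Bot => ord0
  | Atom p => v p
  | And a1 a2 => Order.min (val3 v a1) (val3 v a2)
  | Or a1 a2 => Order.max (val3 v a1) (val3 v a2)
  | Imp a1 a2 => if val3 v a1 <= val3 v a2 then ord_max else val3 v a2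
  end.

Definition is_model v a : bool := val3 v a == ord_max.

(* Values are compared as natural numbers, through the coercion 'I_3 >-> nat. *)
Definition interp_le u v : bool :=
  [forall p, (u p <= v p) && ((u p == 0 :> nat) ==> (v p == 0 :> nat))].

Definition classicals : {set interp Sigma} :=
  [set v : interp Sigma | [forall p, v p != 1 :> nat]].

Definition cpart S : {set interp Sigma} := S :&: classicals.

Definition down S : {set interp Sigma} :=
  [set u | [exists v in S, interp_le u v]].

Definition minimal_model v a : bool :=
  is_model v a && [forall u, is_model u a && interp_le u v ==> (u == v)].

Definition eqmodels a : {set interp Sigma} :=
  [set v in classicals | minimal_model v a].

Fixpoint denot a : {set interp Sigma} :=
  match a with
  | Bot => set0
  | Atom p => [set v : interp Sigma | v p == 2 :> nat]
  | And a1 a2 => denot a1 :&: denot a2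
  | Or a1 a2 => denot a1 :|: denot a2
  | Imp a1 a2 =>
      (~: denot a1 :|: denot a2) :&: down (cpart (~: denot a1 :|: denot a2))
  end.

Definition strongly_entails a b : Prop :=
  forall c : formula Sigma, eqmodels (And a c) \subset eqmodels (And b c).

End Semantics.

(* Main.v *)
Require Import Defs.
From HB Require Import structures.
From mathcomp Require Import all_boot all_order.

(** Every interpretation [u] has a unique classical interpretation [there u]
    above it, and [u] evaluates a formula to [0] exactly when [there u] does;
    hence the denotation of a formula is its set of models, and [u] belongs to
    the down-closure of the classical part of [S] iff [there u] belongs to [S].
    Conditions (i) and (ii) then yield strong entailment directly. Conversely,
    the formula [separator u], the conjunction of the atoms of value [2] and of
    the implications between atoms of value [1], has only [u] and [there u] as
    models below [there u]. Conjoining with [separator v] makes a classical model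
    [v] of [alpha] an equilibrium model, which gives (i); conjoining with
    [separator u] for a [u] violating (ii) makes [there u] an equilibrium model
    on the side of [alpha] only. *)

Set Implicit Arguments.
Unset Strict Implicit.
Unset Printing Implicit Defensive.

Lemma ord3_cases (x : 'I_3) : [\/ x = 0 :> nat, x = 1 :> nat | x = 2 :> nat].
Proof.
by case: x => [[|[|[|x]]] lt_x3] //=; [apply: Or31 | apply: Or32 | apply: Or33].
Qed.

Lemma val_ord_min n (x y : 'I_n) : Order.min x y = minn x y :> nat.
Proof. by rewrite /Order.min ltEord /minn; case: ifP. Qed.

Lemma val_ord_max n (x y : 'I_n) : Order.max x y = maxn x y :> nat.
Proof. by rewrite /Order.max ltEord /maxn; case: ifP. Qed.

Section Interpretations.

Variable Sigma : finType.
Implicit Types (u v w : interp Sigma) (a b c : formula Sigma).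
Implicit Types S : {set interp Sigma}.

Definition there u : interp Sigma :=
  [ffun p => if u p == 0 :> nat then ord0 else ord_max].

Lemma thereE u p : there u p = (if u p == 0 :> nat then 0 else 2) :> nat.
Proof. by rewrite ffunE; case: ifP. Qed.

Lemma there_classical u : there u \in classicals Sigma.
Proof. by rewrite inE; apply/forallP => p; rewrite thereE; case: ifP. Qed.

Lemma classical_neq1 v p : v \in classicals Sigma -> v p != 1 :> nat.
Proof. by rewrite inE => /forallP. Qed.

Lemma there_id v : v \in classicals Sigma -> there v = v.
Proof.
move=> cv; apply/ffunP => p; apply/val_inj; rewrite /= thereE.
by have := classical_neq1 p cv; case: (ord3_cases (v p)) => ->.
Qed.

Lemma interp_leP u v :
  reflect (forall p, u p <= v p /\ (u p = 0 :> nat -> v p = 0 :> nat))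
          (interp_le u v).
Proof.
apply: (iffP forallP) => h p; have := h p.
  by case/andP=> le_uv /implyP z; split=> // u0; apply/eqP/z; rewrite u0.
by case=> -> z; apply/implyP => /eqP/z ->.
Qed.

Lemma interp_le_there u : interp_le u (there u).
Proof.
by apply/interp_leP => p; rewrite thereE; case: (ord3_cases (u p)) => ->.
Qed.

(** The order keeps zeros at zero and nonzero values nonzero; a nonzero classical value can only be
    2. *)
Lemma there_eq u v : v \in classicals Sigma -> interp_le u v -> v = there u.
Proof.
move=> cv /interp_leP le_uv; apply/ffunP => p; apply/val_inj.
rewrite /= thereE; have := classical_neq1 p cv; have [] := le_uv p.
case: (ord3_cases (u p)) => ->; case: (ord3_cases (v p)) => -> //= _ z.
by have := z erefl.
Qed.

Lemma mem_down_cpart S u : (u \in down (cpart S)) = (there u \in S).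
Proof.
rewrite inE; apply/existsP/idP => [[v /andP[]] | Su].
  by rewrite inE => /andP[Sv cv] /(there_eq cv) <-.
by exists (there u); rewrite inE Su there_classical interp_le_there.
Qed.

Lemma is_modelE v a : is_model v a = (val3 v a == 2 :> nat).
Proof. by []. Qed.

(** Sending 0 to 0 and both 1 and 2 to 2 commutes with min, max and the implication of the
    three-element chain. *)
Lemma val3_there u a :
  val3 (there u) a = (if val3 u a == 0 :> nat then 0 else 2) :> nat.
Proof.
elim: a => [|p|a IHa b IHb|a IHa b IHb|a IHa b IHb] //=.
- exact: thereE.
- rewrite !val_ord_min IHa IHb.
  by case: (ord3_cases (val3 u a)) => ->; case: (ord3_cases (val3 u b)) => ->.
- rewrite !val_ord_max IHa IHb.
  by case: (ord3_cases (val3 u a)) => ->; case: (ord3_cases (val3 u b)) => ->.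
- rewrite IHa; rewrite !fun_if /= IHb.
  by case: (ord3_cases (val3 u a)) => ->; case: (ord3_cases (val3 u b)) => ->.
Qed.

Lemma is_model_there u a : is_model u a -> is_model (there u) a.
Proof. by rewrite !is_modelE val3_there => /eqP->. Qed.

Lemma is_modelA v a b : is_model v (And a b) = is_model v a && is_model v b.
Proof.
rewrite !is_modelE /= val_ord_min.
by case: (ord3_cases (val3 v a)) => ->; case: (ord3_cases (val3 v b)) => ->.
Qed.

Lemma is_modelO v a b : is_model v (Or a b) = is_model v a || is_model v b.
Proof.
rewrite !is_modelE /= val_ord_max.
by case: (ord3_cases (val3 v a)) => ->; case: (ord3_cases (val3 v b)) => ->.
Qed.

Lemma is_modelI_le v a b : is_model v (Imp a b) = (val3 v a <= val3 v b).
Proof.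
rewrite !is_modelE /= fun_if.
by case: (ord3_cases (val3 v a)) => ->; case: (ord3_cases (val3 v b)) => ->.
Qed.

(** The inequality of values fails either when [a] has value 2 and [b] less, visible at [v], or when
    they have values 1 and 0, visible only at [there v]. The two conjuncts match the two factors of
    [denot (Imp a b)]. *)
Lemma is_modelI v a b :
  is_model v (Imp a b) = (is_model v a ==> is_model v b) &&
                         (is_model (there v) a ==> is_model (there v) b).
Proof.
rewrite is_modelI_le !is_modelE !val3_there.
by case: (ord3_cases (val3 v a)) => ->; case: (ord3_cases (val3 v b)) => ->.
Qed.

Lemma mem_denot v a : (v \in denot a) = is_model v a.
Proof.
elim: a v => [|p|a IHa b IHb|a IHa b IHb|a IHa b IHb] v.
- by rewrite inE.
- by rewrite inE.
- by rewrite is_modelA inE IHa IHb.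
- by rewrite is_modelO inE IHa IHb.
- by rewrite is_modelI inE mem_down_cpart !inE !IHa !IHb !implybE.
Qed.

Lemma eqmodelsP v a :
  reflect [/\ v \in classicals Sigma, is_model v a &
             forall u, is_model u a -> interp_le u v -> u = v]
          (v \in eqmodels a).
Proof.
rewrite /eqmodels [X in reflect _ X]in_set /minimal_model.
apply: (iffP and3P) => -[cv va min_v]; split=> //.
  by move=> u ua le_uv; apply/eqP/(implyP (forallP min_v u)); rewrite ua.
by apply/forallP => u; apply/implyP => /andP[ua /min_v->].
Qed.

(** [Imp Bot Bot] plays the part of truth, which is not a primitive formula. *)
Definition big_and (s : seq (formula Sigma)) : formula Sigma :=
  foldr (@And Sigma) (Imp Bot Bot) s.

Lemma is_model_big_and v s : is_model v (big_and s) = all (is_model v) s.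
Proof. by elim: s => [|a s IHs]; rewrite //= is_modelA IHs. Qed.

(** All ordered pairs occur, so the implications go both ways. Atoms of value 0 get no conjunct:
    lying below [there u] already fixes them. *)
Definition separator u : formula Sigma :=
  And (big_and [seq Atom p | p <- enum Sigma & u p == 2 :> nat])
      (big_and [seq Imp (Atom pq.1) (Atom pq.2) |
                pq <- enum {: Sigma * Sigma} &
                (u pq.1 == 1 :> nat) && (u pq.2 == 1 :> nat)]).

Lemma separatorP u v :
  reflect ((forall p, u p = 2 :> nat -> v p = 2 :> nat) /\
           (forall p q, u p = 1 :> nat -> u q = 1 :> nat -> v p <= v q))
          (is_model v (separator u)).
Proof.
rewrite is_modelA !is_model_big_and !all_map.
apply: (iffP andP) => -[h2 h1]; split.
- by move=> p up; apply/eqP/(allP h2 p); rewrite mem_filter up mem_enum.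
- move=> p q up uq; rewrite -[_ <= _](is_modelI_le v (Atom p) (Atom q)).
  by apply: (allP h1 (p, q)); rewrite mem_filter /= up uq mem_enum.
- apply/allP => p; rewrite mem_filter => /andP[/eqP/h2 vp _].
  by rewrite /= is_modelE /= vp.
- apply/allP => -[p q]; rewrite mem_filter => /andP[/andP[/eqP up /eqP uq] _].
  by rewrite /= is_modelI_le; apply: h1.
Qed.

Lemma separator_self u : is_model u (separator u).
Proof. by apply/separatorP; split=> // p q -> ->. Qed.

(** The zeros of [w] are those of [u] by the order, the twos of [u] persist, and the ones of [u]
    move together, leaving one choice between 1 and 2. *)
Lemma separator_below u w :
  interp_le w (there u) -> is_model w (separator u) -> w = u \/ w = there u.
Proof.
move=> /interp_leP le_w /separatorP[w2 w1].
have w0 p : u p = 0 :> nat -> w p = 0 :> nat.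
  by move=> up; have [] := le_w p; rewrite thereE up leqn0 => /eqP.
have wn0 p : u p != 0 :> nat -> w p != 0 :> nat.
  have [_] := le_w p; rewrite thereE; case: eqP => // _ z _.
  by apply/eqP => /z.
(* A single atom raised from 1 to 2 raises all the others through the implications. *)
case: (pickP (fun p => (u p == 1 :> nat) && (w p == 2 :> nat))).
  move=> p /andP[/eqP up /eqP wp]; right.
  apply/ffunP => q; apply/val_inj; rewrite /= thereE.
  case: (ord3_cases (u q)) => uq; rewrite uq /=; [exact: w0 | | exact: w2].
  by have := w1 p q up uq; rewrite wp; case: (ord3_cases (w q)) => ->.
move=> no_p; left; apply/ffunP => q; apply/val_inj => /=.
case: (ord3_cases (u q)) => uq; rewrite uq; [exact: w0 | | exact: w2].
have := no_p q; have := wn0 q; rewrite uq /= => /(_ isT).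
by case: (ord3_cases (w q)) => ->.
Qed.

Lemma entails_classically a b v :
  strongly_entails a b -> v \in classicals Sigma -> is_model v a -> is_model v b.
Proof.
move=> ab cv va; have /subsetP sub := ab (separator v).
have /sub/eqmodelsP[_] : v \in eqmodels (And a (separator v)).
  apply/eqmodelsP; split=> [//||u]; rewrite is_modelA.
    by rewrite va separator_self.
  case/andP=> _ sep_u le_uv.
  (* For classical [v] the two candidates [v] and [there v] coincide. *)
  by have := @separator_below v u; rewrite there_id // => /(_ le_uv sep_u) [].
by rewrite is_modelA => /andP[].
Qed.

Lemma entails_downward a b u :
  strongly_entails a b -> is_model (there u) a -> is_model u b -> is_model u a.
Proof.
move=> ab ta ub; apply/negPn/negP => nua; have /subsetP sub := ab (separator u).
(* Of the two candidates, [u] is excluded because it is assumed not to satisfy [a]. *)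
have /sub/eqmodelsP[_ _ min_t] : there u \in eqmodels (And a (separator u)).
  apply/eqmodelsP; split=> [||w]; first exact: there_classical.
    by rewrite is_modelA ta is_model_there ?separator_self.
  rewrite is_modelA => /andP[wa sep_w] le_w.
  by case: (separator_below le_w sep_w) => // wu; rewrite wu (negPf nua) in wa.
(* On the side of [b], [u] is a model below the minimal model [there u]. *)
have ut : u = there u.
  by apply: min_t (interp_le_there u); rewrite is_modelA ub separator_self.
by rewrite -ut (negPf nua) in ta.
Qed.

End Interpretations.

Theorem theorem9 (Sigma : finType) (alpha beta : formula Sigma) :
  strongly_entails alpha beta <->
  (cpart (denot alpha) \subset cpart (denot beta) /\
   down (cpart (denot alpha)) :&: denot beta \subset denot alpha).
Proof.
split=> [ab | [/subsetP sub_c /subsetP sub_d] gamma].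
  split; apply/subsetP => u.
    rewrite !inE !mem_denot => /andP[ua cu].
    by apply/andP; split=> //; apply: entails_classically ab _ _; rewrite ?inE.
  rewrite in_setI mem_down_cpart !mem_denot => /andP[ta ub].
  exact: entails_downward ab ta ub.
apply/subsetP => v /eqmodelsP[cv]; rewrite is_modelA => /andP[va vg] min_v.
have vb : is_model v beta.
  have /sub_c : v \in cpart (denot alpha) by rewrite in_setI mem_denot va.
  by rewrite in_setI mem_denot => /andP[].
apply/eqmodelsP; split=> [//||u]; rewrite is_modelA ?vb //.
case/andP=> ub ug le_uv; apply: min_v => //; rewrite is_modelA ug andbT.
(* Condition (ii) turns a model of [beta] below [v] into a model of [alpha], since [v] is [there u];
   minimality for [alpha] then applies. *)
rewrite -mem_denot; apply: sub_d.
by rewrite in_setI mem_down_cpart !mem_denot -(there_eq cv le_uv) va.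
Qed.
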